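(* Let $(A,[-,-],\alpha)$ be a Hom-Malcev algebra. Then there exists a compatible Hom-pre-Malcev algebra structure on $A$ (that is, a Hom-pre-Malcev algebra $(A,\cdot,\alpha)$ with $x\cdot y-y\cdot x=[x,y]$ for all $x,y\in A$) if and only if there is an invertible $\mathcal O$-operator on $A$ (that is, a representation $(V,\rho,\beta)$ of $(A,[-,-],\alpha)$ and an invertible linear map $T:V\to A$ which is an $\mathcal O$-operator associated to $(V,\rho,\beta)$).
   Context: All vector spaces are over a field $\mathbb K$ of characteristic $0$. A Hom-algebra $(A,\mu,\alpha)$ is a vector space $A$ with a bilinear map $\mu:A\times A\to A$ and a linear map $\alpha:A\to A$; all Hom-algebras are assumed multiplicative, i.e. $\alpha(\mu(x,y))=\mu(\alpha(x),\alpha(y))$. A Hom-Malcev algebra is a Hom-algebra $(A,[-,-],\alpha)$ with $[-,-]$ anti-symmetric and, for all $x,y,z\in A$, $J_\alpha(\alpha(x),\alpha(y),[x,z])=[J_\alpha(x,y,z),\alpha^2(x)]$, where $J_\alpha(x,y,z)=[[x,y],\alpha(z)]+[[y,z],\alpha(x)]+[[z,x],\alpha(y)]$. A representation of a Hom-Malcev algebra $(A,[-,-],\alpha)$ is a triple $(V,\rho,\beta)$ with $V$ a vector space, $\rho:A\to \mathrm{End}(V)$ linear, $\beta\in \mathrm{End}(V)$, such that for all $x,y,z\in A$: $\rho(\alpha(x))\beta=\beta\rho(x)$ and $$\rho([[x,y],\alpha(z)])\beta^2=\rho(\alpha^2(x))\rho(\alpha(y))\rho(z)-\rho(\alpha^2(z))\rho(\alpha(x))\rho(y)+\rho(\alpha^2(y))\rho([z,x])\beta-\rho(\alpha([y,z]))\rho(\alpha(x))\beta.$$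 An $\mathcal O$-operator of $(A,[-,-],\alpha)$ associated to $(V,\rho,\beta)$ is a linear map $T:V\to A$ with $\alpha\circ T=T\circ\beta$ and $[T(a),T(b)]=T(\rho(T(a))b-\rho(T(b))a)$ for all $a,b\in V$. A Hom-pre-Malcev algebra is a Hom-algebra $(A,\cdot,\alpha)$ such that, with $[x,y]=x\cdot y-y\cdot x$, for all $x,y,z,t\in A$: $$[\alpha(y),\alpha(z)]\cdot\alpha(x\cdot t)+[[x,y],\alpha(z)]\cdot\alpha^2(t)+\alpha^2(y)\cdot([x,z]\cdot\alpha(t))-\alpha^2(x)\cdot(\alpha(y)\cdot(z\cdot t))+\alpha^2(z)\cdot(\alpha(x)\cdot(y\cdot t))=0.$$ *)

(* Defs.v *)
From HB Require Import structures.
From mathcomp Require Import all_boot all_order all_algebra.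

Set Implicit Arguments.
Unset Strict Implicit.
Unset Printing Implicit Defensive.

Import GRing.Theory.
Local Open Scope ring_scope.

Definition multiplicative_hom_algebra (K : fieldType) (A : lmodType K)
    (mu : {bilinear A -> A -> A}) (alpha : {linear A -> A}) : Prop :=
  forall x y : A, alpha (mu x y) = mu (alpha x) (alpha y).

Definition hom_jacobian (K : fieldType) (A : lmodType K)
    (br : {bilinear A -> A -> A}) (alpha : {linear A -> A}) (x y z : A) : A :=
  br (br x y) (alpha z) + br (br y z) (alpha x) + br (br z x) (alpha y).

Record hom_malcev (K : fieldType) (A : lmodType K)
    (br : {bilinear A -> A -> A}) (alpha : {linear A -> A}) : Prop := HomMalcev {
  hom_malcev_mult : multiplicative_hom_algebra br alpha;
  hom_malcev_anti : forall x y : A, br x y = - br y x;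
  hom_malcev_id : forall x y z : A,
    hom_jacobian br alpha (alpha x) (alpha y) (br x z)
    = br (hom_jacobian br alpha x y z) (alpha (alpha x))
}.

(* MathComp puts no module structure on {linear V -> V}, so linearity of
   rho : A -> End(V) is stated pointwise. *)
Record hom_malcev_rep (K : fieldType) (A : lmodType K)
    (br : {bilinear A -> A -> A}) (alpha : {linear A -> A})
    (V : lmodType K) (rho : A -> {linear V -> V}) (beta : {linear V -> V})
    : Prop := HomMalcevRep {
  rep_linear : forall (k : K) (x y : A) (v : V),
    rho (k *: x + y) v = k *: rho x v + rho y v;
  rep_twist : forall (x : A) (v : V), rho (alpha x) (beta v) = beta (rho x v);
  rep_id : forall (x y z : A) (v : V),
    rho (br (br x y) (alpha z)) (beta (beta v))
    = rho (alpha (alpha x)) (rho (alpha y) (rho z v))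
      - rho (alpha (alpha z)) (rho (alpha x) (rho y v))
      + rho (alpha (alpha y)) (rho (br z x) (beta v))
      - rho (alpha (br y z)) (rho (alpha x) (beta v))
}.

Record O_operator (K : fieldType) (A : lmodType K)
    (br : {bilinear A -> A -> A}) (alpha : {linear A -> A})
    (V : lmodType K) (rho : A -> {linear V -> V}) (beta : {linear V -> V})
    (T : {linear V -> A}) : Prop := OOperator {
  O_operator_twist : forall v : V, alpha (T v) = T (beta v);
  O_operator_id : forall a b : V,
    br (T a) (T b) = T (rho (T a) b - rho (T b) a)
}.

Definition commutator (K : fieldType) (A : lmodType K)
    (dot : {bilinear A -> A -> A}) (x y : A) : A := dot x y - dot y x.

Record hom_pre_malcev (K : fieldType) (A : lmodType K)
    (dot : {bilinear A -> A -> A}) (alpha : {linear A -> A})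
    : Prop := HomPreMalcev {
  hom_pre_malcev_mult : multiplicative_hom_algebra dot alpha;
  hom_pre_malcev_id : forall x y z t : A,
    dot (commutator dot (alpha y) (alpha z)) (alpha (dot x t))
    + dot (commutator dot (commutator dot x y) (alpha z)) (alpha (alpha t))
    + dot (alpha (alpha y)) (dot (commutator dot x z) (alpha t))
    - dot (alpha (alpha x)) (dot (alpha y) (dot z t))
    + dot (alpha (alpha z)) (dot (alpha x) (dot y t)) = 0
}.

(* Main.v *)
(* From a Hom-pre-Malcev product, left multiplication is a representation of A
   on itself for which the identity is an O-operator.  Conversely, an invertible
   O-operator T transports the action to A as x . y = T (rho x (T^-1 y)). *)
Require Import Defs.
From HB Require Import structures.
From mathcomp Require Import all_boot all_order all_algebra.

Set Implicit Arguments.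
Unset Strict Implicit.
Unset Printing Implicit Defensive.

Import GRing.Theory.
Local Open Scope ring_scope.

(** Serves both directions: in the Hom-pre-Malcev identity, [b] is the product by [[[x, y], alpha
    z]], the term that the representation identity has alone on its left-hand side. *)
Lemma hom_pre_malcev_id_solved (V : zmodType) (a b c d e : V) :
  (a + b + c - d + e == 0) = (b == d - e - c - a).
Proof.
rewrite -[RHS]subr_eq0 !opprD !opprK; congr (_ == 0).
by rewrite !addrA [RHS](ACl (5*1*4*2*3)).
Qed.

Lemma hom_pre_malcev_O_operator (K : fieldType) (A : lmodType K)
    (br dot : {bilinear A -> A -> A}) (alpha : {linear A -> A}) :
  hom_pre_malcev dot alpha -> (forall x y, dot x y - dot y x = br x y) ->
  hom_malcev_rep br alpha (fun x => dot x : {linear A -> A}) alpha /\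
  O_operator br alpha (fun x => dot x : {linear A -> A}) alpha idfun.
Proof.
move=> [dotM dotP] dotB; split; split => //=.
- by move=> k x y v; rewrite linearPl.
- move=> x y z v; have := dotP x y z v.
  (* Expanding [br (alpha y) (alpha z)] back into products lets multiplicativity of [dot] turn it
     into [alpha (br y z)], as [rep_id] requires. *)
  rewrite /commutator !dotB -(dotB (alpha y)) -!dotM -linearB dotB => /eqP.
  have -> : br z x = - br x z by rewrite -!dotB opprB.
  rewrite hom_pre_malcev_id_solved linearNl linearN => /eqP ->.
  by rewrite !dotM.
Qed.

Definition O_operator_dot (K : fieldType) (A V : lmodType K)
    (rho : A -> {linear V -> V}) (T : {linear V -> A}) (g : A -> V)
    (x y : A) : A := T (rho x (g y)).

(** Linearity on the right needs [g] linear, which it inherits from [T] as its two-sided inverse. *)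
Lemma O_operator_dot_bilinear (K : fieldType) (A V : lmodType K)
    (rho : A -> {linear V -> V}) (T : {linear V -> A}) (g : A -> V) :
  (forall (k : K) x y v, rho (k *: x + y) v = k *: rho x v + rho y v) ->
  cancel T g -> cancel g T ->
  bilinear_for *:%R *:%R (O_operator_dot rho T g).
Proof.
move=> rhoP Tg gT; rewrite /O_operator_dot; split=> [v k x y | x k y z].
  by rewrite rhoP linearP.
by rewrite (can2_linear Tg gT) !linearP.
Qed.

(** The Hom-pre-Malcev identity at [t] is the image under [T] of the representation identity at
    [g t]; multiplicativity comes from the two twist conditions. *)
Lemma O_operator_hom_pre_malcev (K : fieldType) (A V : lmodType K)
    (br : {bilinear A -> A -> A}) (alpha : {linear A -> A})
    (rho : A -> {linear V -> V}) (beta : {linear V -> V})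
    (T : {linear V -> A}) :
  hom_malcev br alpha -> hom_malcev_rep br alpha rho beta -> bijective T ->
  O_operator br alpha rho beta T ->
  exists dot : {bilinear A -> A -> A},
    hom_pre_malcev dot alpha /\ (forall x y, dot x y - dot y x = br x y).
Proof.
move=> [brM brA _] [rhoP rho_tw rho_id] [g Tg gT] [T_tw T_id].
pose dotB := bilinear_isBilinear.Build K A A A *:%R *:%R _
  (O_operator_dot_bilinear rhoP Tg gT).
pose dot : {bilinear A -> A -> A} := HB.pack (O_operator_dot rho T g) dotB.
have dotE x y : dot x y = T (rho x (g y)) by [].
have commE x y : dot x y - dot y x = br x y.
  by have := T_id (g x) (g y); rewrite !gT linearB.
exists dot; split=> //.
have g_tw x : g (alpha x) = beta (g x) by rewrite -{1}(gT x) T_tw Tg.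
split=> [x y | x y z t]; first by rewrite !dotE g_tw rho_tw T_tw.
(* Nested products cancel [g] against [T], so each term is [T] of an expression in [rho] and [beta]
   at [g t]. *)
rewrite /commutator !commE !dotE !g_tw !Tg.
(* [rho] is a plain function, so its behaviour on zero and opposites is drawn from [rhoP] with
   scalar -1. *)
have rho0 v : rho 0 v = 0.
  by have := rhoP (-1) 0 0 v; rewrite scaler0 addr0 scaleN1r addNr.
have rhoN u v : rho (- u) v = - rho u v.
  by rewrite -[- u]addr0 -scaleN1r rhoP rho0 addr0 scaleN1r.
(* Two mismatches remain: the sign between [[z, x]] and [[x, z]], and the position of [alpha] and
   [beta] in the last term. *)
apply/eqP; rewrite hom_pre_malcev_id_solved rho_id (brA z x) rhoN -brM -rho_tw.
by rewrite linearN !linearB.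
Qed.

Theorem proposition3p3 (K : fieldType) (charK : [pchar K] =i pred0)
    (A : lmodType K) (br : {bilinear A -> A -> A}) (alpha : {linear A -> A})
    (malcevA : hom_malcev br alpha) :
  (exists dot : {bilinear A -> A -> A},
     hom_pre_malcev dot alpha /\
     (forall x y : A, dot x y - dot y x = br x y))
  <->
  (exists (V : lmodType K) (rho : A -> {linear V -> V})
          (beta : {linear V -> V}) (T : {linear V -> A}),
     [/\ hom_malcev_rep br alpha rho beta,
         bijective T
       & O_operator br alpha rho beta T]).
Proof.
split=> [[dot [dotP dotB]] | [V [rho [beta [T [repV bijT opT]]]]]].
  have [repA opA] := hom_pre_malcev_O_operator dotP dotB.
  exists A, (fun x => dot x : {linear A -> A}), alpha, idfun.
  by split=> //; exists idfun.
exact: O_operator_hom_pre_malcev repV bijT opT.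
Qed.
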